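(* Assume that $g$ and $\psi_{\ell-1}$, $\ell\in[L]$, are twice directionally differentiable everywhere on $\mathbb{R}^{\bar N_L}$ and $\mathbb{R}^{n+\bar N_{\ell-1}}$, $\ell\in[L]$, respectively, and locally Lipschitz continuous. Let the penalty parameters $\beta_\ell>0$ satisfy $$\beta_\ell>K_g\prod_{j=\ell+1}^{L}(1+K_{j-1})\quad\text{for all }\ell\in[L],$$ where $K_g$ and $K_1,\dots,K_{L-1}$ are the Lipschitz constants described in the context. Then $$\mathcal{SD}_0\cap lev_{\le\bar\gamma}\Theta\ \supseteq\ \mathcal{SD}_1\cap lev_{\le\bar\gamma}\Theta.$$
   Context: Let $n,L,N_1,\dots,N_L$ be positive integers, $[L]=\{1,\dots,L\}$, $\bar N_0=0$, $\bar N_\ell=\sum_{j=1}^{\ell}N_j$, $\bar N=n+\bar N_L$, $\lambda>0$. Let $g:\mathbb{R}^{\bar N_L}\to[0,\infty)$ and $\psi_{\ell-1}:\mathbb{R}^{n+\bar N_{\ell-1}}\to\mathbb{R}^{N_\ell}$ ($\ell\in[L]$) be continuous. Write $u=(u_1,\dots,u_L)$ with $u_\ell\in\mathbb{R}^{N_\ell}$, $\mathbf{u}_\ell=(u_1,\dots,u_\ell)$, $\mathbf{u}_0$ empty, $z=(\theta,u)\in\mathbb{R}^{\bar N}$ with $\theta\in\mathbb{R}^n$. $\|\cdot\|$ is the Euclidean norm. Empty products equal $1$. $F(z)=g(u)+\lambda\|\theta\|^2$; $\mathcal{F}_0=\{z\mid u_\ell=\psi_{\ell-1}(\theta,\mathbf{u}_{\ell-1}),\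 \ell\in[L]\}$; $\Theta(z)=F(z)+\sum_{\ell=1}^{L}\beta_\ell\|u_\ell-\psi_{\ell-1}(\theta,\mathbf{u}_{\ell-1})\|_1$ with $\beta_\ell>0$. Problem (P0) is $\min_{z\in\mathcal{F}_0}F(z)$; problem (P1) is $\min_{z\in\mathbb{R}^{\bar N}}\Theta(z)$. Directional derivative: $f'(x;d)=\lim_{\tau\downarrow0}\frac{f(x+\tau d)-f(x)}{\tau}$; second-order: $f^{(2)}(x;d)=\lim_{\tau\downarrow0}\frac{f(x+\tau d)-f(x)-\tau f'(x;d)}{\tau^2/2}$ (componentwise for vector-valued $f$); $f$ is twice directionally differentiable at $x$ if both limits exist for all $d$. Tangent cone: $\mathcal{T}_{\mathcal{F}}(x)=\{d\mid\exists\,x^k\to x,\ x^k\in\mathcal{F},\ \tau_k\downarrow0\text{ with }(x^k-x)/\tau_k\to d\}$. Radial cone: $P_{\mathcal{F}}(x)=\{d\mid\exists\,\tau_k\downarrow0\text{ such that }x+\tau_kd\in\mathcal{F}\text{ for all }k\}$. Stationary sets: $\mathcal{D}_0=\{z\in\mathcal{F}_0\mid F'(z;d)\ge0\ \forall d\in\mathcal{T}_{\mathcal{F}_0}(z)\}$, $\mathcal{D}_1=\{z\in\mathbb{R}^{\bar N}\mid\Theta'(z;d)\ge0\ \forall d\in\mathbb{R}^{\bar N}\}$; the sets of second-order d-stationary points of (P0) and (P1) are $\mathcal{SD}_0=\{z\in\mathcal{D}_0\mid F^{(2)}(z;d)\ge0\ \forall d\in P_{\mathcal{F}_0}(z)\text{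 with }F'(z;d)=0\}$ and $\mathcal{SD}_1=\{z\in\mathcal{D}_1\mid\Theta^{(2)}(z;d)\ge0\ \forall d\in\mathbb{R}^{\bar N}\text{ with }\Theta'(z;d)=0\}$. Level $\bar\gamma$: let $z^0=(\mathbf{0},u_1^0,\dots,u_L^0)$ with $u_\ell^0=\psi_{\ell-1}(\mathbf{0},u_1^0,\dots,u_{\ell-1}^0)$ for $\ell=1,\dots,L$, and $\bar\gamma=\Theta(z^0)=F(z^0)$. Let $lev_{\le\bar\gamma}\Theta=\{z\mid\Theta(z)\le\bar\gamma\}$ (a compact set). Lipschitz constants: $K_g>0$ and $K_\ell>0$ ($\ell\in[L-1]$) are constants such that for some (sufficiently small) $\epsilon>0$, $|g(u)-g(\bar u)|\le K_g\|u-\bar u\|$ and $\|\psi_{\ell-1}(\theta,\mathbf{u}_{\ell-1})-\psi_{\ell-1}(\theta,\bar{\mathbf{u}}_{\ell-1})\|\le K_{\ell-1}\|\mathbf{u}_{\ell-1}-\bar{\mathbf{u}}_{\ell-1}\|$ for $\ell=2,\dots,L$, for all $(\theta,u),(\theta,\bar u)\in lev_{\le\bar\gamma}\Theta+\epsilon\mathbb{B}$, where $\mathbb{B}$ is the closed unit ball of $\mathbb{R}^{\bar N}$. (Such constants exist under the stated local Lipschitz assumption.) *)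

(* Defs.v *)
From HB Require Import structures.
From mathcomp Require Import all_boot all_order all_algebra.
From mathcomp Require Import all_classical all_reals all_analysis.

Set Implicit Arguments.
Unset Strict Implicit.
Unset Printing Implicit Defensive.

Import Order.TTheory GRing.Theory Num.Theory.
Import numFieldNormedType.Exports.

Local Open Scope classical_set_scope.
Local Open Scope ring_scope.

(* The norm `|_| that MathComp-Analysis puts on row vectors is the maximum
   norm, so the Euclidean norm and the 1-norm are defined here. *)
Definition norm2 (R : realType) (m : nat) (x : 'rV[R]_m) : R :=
  Num.sqrt (\sum_(i < m) x ord0 i ^+ 2).

Definition norm1 (R : realType) (m : nat) (x : 'rV[R]_m) : R :=
  \sum_(i < m) `|x ord0 i|.

Section directional.
Context {R : realType} {V W : normedModType R}.
Implicit Types (f : V -> W) (x d : V).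

Definition dquot f x d (t : R) : W := t^-1 *: (f (x + t *: d) - f x).

Definition dderiv f x d : W := lim (dquot f x d t @[t --> 0^'+]).

Definition dquot2 f x d (t : R) : W :=
  (t ^+ 2 / 2)^-1 *: (f (x + t *: d) - f x - t *: dderiv f x d).

Definition dderiv2 f x d : W := lim (dquot2 f x d t @[t --> 0^'+]).

Definition twice_ddifferentiable f x : Prop :=
  forall d, cvg (dquot f x d t @[t --> 0^'+]) /\
            cvg (dquot2 f x d t @[t --> 0^'+]).

Definition tangent_cone (S : set V) x : set V :=
  [set d | exists (y : nat -> V) (tau : nat -> R),
     [/\ y @ \oo --> x, forall k, S (y k),
         forall k, 0 < tau k, tau @ \oo --> 0
       & ((tau k)^-1 *: (y k - x)) @[k --> \oo] --> d]].

Definition radial_cone (S : set V) x : set V :=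
  [set d | exists tau : nat -> R,
     [/\ forall k, 0 < tau k, tau @ \oo --> 0
       & forall k, S (x + tau k *: d)]].

(* The library's lipschitz is relative to its own norm (the maximum norm on row
   vectors); in finite dimension this does not change the property. *)
Definition locally_lipschitz f : Prop :=
  forall x, exists2 A : set V, nbhs x A & [lipschitz f y | y in A].

End directional.

(* Layers are numbered from 0: the index l : 'I_L below is the layer l + 1 of
   the mathematical text, of dimension N l, and psi l is the map psi_l
   that defines it from theta and the layers before it.  Only the values of N
   below L matter. *)
Definition Nbar (N : nat -> nat) (l : nat) : nat := (\sum_(j < l) N j)%N.

Section penalty.
Context {R : realType} {n L : nat} {N : nat -> nat}.
Variables (lambda : R) (beta : 'I_L -> R).
Variables (g : 'rV[R]_(Nbar N L) -> R)
  (psi : forall l : 'I_L, 'rV[R]_(n + Nbar N l) -> 'rV[R]_(N l)).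

Arguments psi : clear implicits.

Local Notation U := 'rV[R]_(Nbar N L).
Local Notation Z := 'rV[R]_(n + Nbar N L).

Definition theta_of (z : Z) : 'rV[R]_n := lsubmx z.
Definition u_of (z : Z) : U := rsubmx z.

Definition layer (u : U) (l : 'I_L) : 'rV[R]_(N l) :=
  submxrow (q_ := fun j : 'I_L => N j) u l.

(* the layers strictly before l *)
Definition prefix (u : U) (l : 'I_L) : 'rV[R]_(Nbar N l) :=
  \mxrow_(j < l) layer u (widen_ord (ltnW (ltn_ord l)) j).

Definition psi_at (theta : 'rV[R]_n) (u : U) (l : 'I_L) : 'rV[R]_(N l) :=
  psi l (row_mx theta (prefix u l)).

Definition objF (z : Z) : R := g (u_of z) + lambda * norm2 (theta_of z) ^+ 2.

Definition feasible0 : set Z :=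
  [set z | forall l : 'I_L, layer (u_of z) l = psi_at (theta_of z) (u_of z) l].

Definition objTheta (z : Z) : R :=
  objF z + \sum_(l < L)
    beta l * norm1 (layer (u_of z) l - psi_at (theta_of z) (u_of z) l).

Definition D0 : set Z :=
  [set z | feasible0 z /\
     forall d, tangent_cone feasible0 z d -> 0 <= dderiv objF z d].

Definition D1 : set Z := [set z | forall d, 0 <= dderiv objTheta z d].

Definition SD0 : set Z :=
  [set z | D0 z /\
     forall d, radial_cone feasible0 z d -> dderiv objF z d = 0 ->
       0 <= dderiv2 objF z d].

Definition SD1 : set Z :=
  [set z | D1 z /\
     forall d, dderiv objTheta z d = 0 -> 0 <= dderiv2 objTheta z d].

(* u0 solves u_l = psi_l(0, u_0, ..., u_(l-1)), l < L.  Starting from any u,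
   each pass over all layers makes one more layer correct, so that L passes
   are enough; see z0_theta and z0_feasible. *)
Definition u0 : U :=
  iter L (fun u : U => \mxrow_(l < L) psi_at 0 u l) 0.

Definition z0 : Z := row_mx 0 u0.

Definition gammabar : R := objTheta z0.

Definition levTheta : set Z := [set z | objTheta z <= gammabar].

Definition lev_nbhd (eps : R) : set Z :=
  [set y + w | y in levTheta & w in [set w : Z | norm2 w <= eps]].

(* K l is the constant of psi l; K is not used at l = 0, since psi 0 depends
   on theta only. *)
Definition lipschitz_constants (Kg : R) (K : 'I_L -> R) : Prop :=
  exists2 eps : R, 0 < eps &
    forall (theta : 'rV[R]_n) (u v : U),
      lev_nbhd eps (row_mx theta u) -> lev_nbhd eps (row_mx theta v) ->
      `|g u - g v| <= Kg * norm2 (u - v) /\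
      forall l : 'I_L, (0 < l)%N ->
        norm2 (psi_at theta u l - psi_at theta v l)
          <= K l * norm2 (prefix u l - prefix v l).

Lemma z0_theta : theta_of z0 = 0.
Proof. exact: row_mxKl. Qed.

Lemma z0_feasible : feasible0 z0.
Proof.
move=> l; rewrite z0_theta /u_of /z0 row_mxKr /u0.
set step := (fun u : U => _).
have stepE u (j : 'I_L) : layer (step u) j = psi_at 0 u j by exact: mxrowK.
suff H k (j : 'I_L) : (j < k)%N ->
    layer (iter k step 0) j = layer (iter k.+1 step 0) j.
  by rewrite H ?ltn_ord// iterS stepE.
elim: k j => // k IH j jk.
rewrite iterS [in RHS]iterS !stepE /psi_at; congr (psi _ (row_mx _ _)).
apply: eq_mxrow => i.
by apply: (IH (widen_ord _ i)); apply: leq_trans (ltn_ord i) _.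
Qed.

End penalty.

(* Main.v *)
Require Import Defs.
From HB Require Import structures.
From mathcomp Require Import all_boot all_order all_algebra.
From mathcomp Require Import all_classical all_reals all_analysis.
From mathcomp Require Import ring lra.
Import Order.TTheory GRing.Theory Num.Theory.
Import numFieldNormedType.Exports.
Local Open Scope classical_set_scope.
Local Open Scope ring_scope.

(** Write [r_l(z) = u_l - psi_l(theta, u_0, ..., u_(l-1))] for the residual of
    layer [l], so that [Theta = F + sum_l beta_l |r_l|_1] and feasibility
    means that every residual vanishes.

    A first-order stationary point [z] of [Theta] in the level set is feasible
    ([D1_lev_feasible]). Keep [theta] fixed and solve layer by layer for the
    direction [v] along which every residual satisfies [r_l'(z; v) = -
    r_l(z)], that is [v_l = psi_l'(.; v_0, ..., v_(l-1)) - r_l(z)]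
    ([layers_rec]). Along it the penalty decreases at the rate [sum_l beta_l
    |r_l(z)|_1] ([dquot_norm1], [objTheta_dderiv]). The Lipschitz constants
    give [|v_l| <= |r_l(z)| + K_l |(v_0, ..., v_(l-1))|], whence [|v| <= sum_l
    |r_l(z)| prod_(j > l) (1 + K_j)] ([discrete_gronwall]), and [F] increases
    at a rate of at most [Kg |v|]. Since [beta_l] exceeds [Kg prod_(j > l) (1
    + K_j)], the derivative of [Theta] would be negative unless all residuals
    vanish.

    At a feasible [z], the penalty is invisible along the directions that
    matter. A tangent direction is the limit of chords to feasible points, so
    the Lipschitz residuals have zero derivative along it ([tangent_residual])
    and [Theta'(z; d) = F'(z; d)]. Along a radial direction the residuals
    vanish at points arbitrarily close to [z] on the ray itself, so both their
    first and second derivatives, which exist, are zero ([radial_residual]);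
    hence also [Theta''(z; d) = F''(z; d)] ([objTheta_dderiv2]). The
    stationarity inequalities for [Theta] are thus those for [F]. *)

Set Implicit Arguments.
Unset Strict Implicit.
Unset Printing Implicit Defensive.

(** * The Euclidean norm, the 1-norm and the maximum norm of row vectors *)

Section Euclid.
Context {R : realType}.

Lemma norm2_ge0 m (x : 'rV[R]_m) : 0 <= norm2 x.
Proof. exact: sqrtr_ge0. Qed.

Lemma sqr_norm2 m (x : 'rV[R]_m) : norm2 x ^+ 2 = \sum_(i < m) x ord0 i ^+ 2.
Proof. by rewrite sqr_sqrtr// sumr_ge0// => i _; exact: sqr_ge0. Qed.

Lemma norm2Z m a (x : 'rV[R]_m) : norm2 (a *: x) = `|a| * norm2 x.
Proof.
rewrite -sqrtr_sqr -sqrtrM ?sqr_ge0// mulr_sumr; congr Num.sqrt.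
by apply: eq_bigr => i _; rewrite mxE exprMn.
Qed.

Lemma norm2_eq0 m (x : 'rV[R]_m) : norm2 x = 0 -> x = 0.
Proof.
move=> x0; have /eqP : norm2 x ^+ 2 = 0 by rewrite x0 expr0n.
rewrite sqr_norm2 psumr_eq0 => [/allP sq0|i _]; last exact: sqr_ge0.
apply/rowP => i; rewrite mxE; apply/eqP.
by have := sq0 i; rewrite mem_index_enum sqrf_eq0; exact.
Qed.

(** Expand [0 <= sum_i (|y| x_i - |x| y_i)^2] and divide by [|x| |y|]. *)
Lemma Cauchy_Schwarz m (x y : 'rV[R]_m) :
  \sum_(i < m) x ord0 i * y ord0 i <= norm2 x * norm2 y.
Proof.
have [/eqP xy0|xy0] := boolP (norm2 x * norm2 y == 0).
  rewrite xy0 big1// => i _; move/eqP: xy0; rewrite mulf_eq0.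
  by case/orP => /eqP/norm2_eq0 ->; rewrite mxE ?mul0r ?mulr0.
have xy_gt0 : 0 < norm2 x * norm2 y.
  by rewrite lt_def xy0 mulr_ge0 ?norm2_ge0.
have : 0 <= \sum_(i < m) (norm2 y * x ord0 i - norm2 x * y ord0 i) ^+ 2.
  by rewrite sumr_ge0// => i _; exact: sqr_ge0.
have -> : \sum_(i < m) (norm2 y * x ord0 i - norm2 x * y ord0 i) ^+ 2 =
    norm2 y ^+ 2 * \sum_(i < m) x ord0 i ^+ 2
    + norm2 x ^+ 2 * \sum_(i < m) y ord0 i ^+ 2
    - 2 * (norm2 x * norm2 y) * \sum_(i < m) x ord0 i * y ord0 i.
  rewrite !mulr_sumr -sumrN -!big_split/=.
  by apply: eq_bigr => i _; ring.
rewrite -!sqr_norm2; nra.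
Qed.

Lemma ler_norm2D m (x y : 'rV[R]_m) : norm2 (x + y) <= norm2 x + norm2 y.
Proof.
rewrite -(@ler_pXn2r _ 2)// ?nnegrE ?addr_ge0 ?norm2_ge0//.
rewrite sqrrD !sqr_norm2.
under eq_bigr do rewrite mxE sqrrD.
rewrite !big_split/= lerD2r lerD2l.
by rewrite mulr2n lerD// Cauchy_Schwarz.
Qed.

Lemma norm2N m (x : 'rV[R]_m) : norm2 (- x) = norm2 x.
Proof. by rewrite -scaleN1r norm2Z normrN1 mul1r. Qed.

Lemma ler_sum_sqr (I : finType) (a : I -> R) : (forall i, 0 <= a i) ->
  \sum_i a i ^+ 2 <= (\sum_i a i) ^+ 2.
Proof.
move=> a0; rewrite expr2 mulr_suml; apply: ler_sum => i _.
rewrite expr2 ler_wpM2l// (bigD1 i)//= lerDl; exact: sumr_ge0.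
Qed.

Lemma norm2_le_norm1 m (x : 'rV[R]_m) : norm2 x <= norm1 x.
Proof.
have n1 : 0 <= norm1 x by exact: sumr_ge0.
rewrite -(@ler_pXn2r _ 2)// ?nnegrE ?norm2_ge0// sqr_norm2.
under eq_bigr do rewrite -real_normK ?num_real//.
exact: ler_sum_sqr.
Qed.

(** The square of the left side is the sum of the squares of the norms of the
    blocks; this weaker form is what fits the recursion over the layers. *)
Lemma norm2_mxrow_le q (q_ : 'I_q -> nat) (B : forall j, 'rV[R]_(q_ j)) :
  norm2 (\mxrow_j B j) <= \sum_j norm2 (B j).
Proof.
have dotE m (x : 'rV[R]_m) : norm2 x ^+ 2 = (x *m x^T) ord0 ord0.
  by rewrite sqr_norm2 mxE; apply: eq_bigr => i _; rewrite mxE expr2.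
have n0 : forall j, 0 <= norm2 (B j) by move=> j; exact: norm2_ge0.
rewrite -(@ler_pXn2r _ 2)// ?nnegrE ?norm2_ge0 ?sumr_ge0//.
rewrite dotE tr_mxrow mul_mxrow_mxcol summxE.
under eq_bigr do rewrite -dotE.
exact: ler_sum_sqr.
Qed.

Lemma cvgr_sum (T : Type) (F : set_system T) {FF : Filter F} (I : finType)
    (f : I -> T -> R) (l : I -> R) :
  (forall i, f i t @[t --> F] --> l i) ->
  \sum_i f i t @[t --> F] --> \sum_i l i.
Proof. by move=> fl; apply: cvg_big => //; exact: add_continuous. Qed.

Lemma norm2_continuous m : continuous (@norm2 R m).
Proof.
move=> x; apply: (@continuous_comp _ _ _ (fun y : 'rV[R]_m =>
  \sum_(i < m) y ord0 i ^+ 2) Num.sqrt); last exact: sqrt_continuous.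
apply: (@cvgr_sum _ (nbhs x)) => i.
apply: (@continuous_comp _ _ _ (fun y : 'rV[R]_m => y ord0 i)
  (fun t => t ^+ 2)).
  exact: coord_continuous.
exact: exprn_continuous.
Qed.

Lemma norm1_continuous m : continuous (@norm1 R m).
Proof.
move=> x; apply: (@cvgr_sum _ (nbhs x)) => i.
by apply: cvg_norm; exact: coord_continuous.
Qed.

Lemma norm1_ge0 m (x : 'rV[R]_m) : 0 <= norm1 x.
Proof. exact: sumr_ge0. Qed.

Lemma norm1_0 m : norm1 (0 : 'rV[R]_m) = 0.
Proof. by apply: big1 => i _; rewrite mxE normr0. Qed.

Lemma norm1_eq0 m (x : 'rV[R]_m) : norm1 x = 0 -> x = 0.
Proof.
move=> x0; apply: norm2_eq0; apply: le_anti.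
by rewrite norm2_ge0 andbT -x0 norm2_le_norm1.
Qed.

Lemma norm1Z m a (x : 'rV[R]_m) : norm1 (a *: x) = `|a| * norm1 x.
Proof.
by rewrite mulr_sumr; apply: eq_bigr => i _; rewrite mxE normrM.
Qed.

Lemma ler_norm1_dist m (x y : 'rV[R]_m) :
  `|norm1 x - norm1 y| <= norm1 (x - y).
Proof.
rewrite -sumrB; apply: le_trans (ler_norm_sum _ _ _) _.
apply: ler_sum => i _; rewrite !mxE; exact: ler_dist_dist.
Qed.

Lemma mx_norm_le m (x : 'rV[R]_m) (a : R) : 0 <= a ->
  (forall i, `|x ord0 i| <= a) -> `|x| <= a.
Proof.
move=> a0 xa; rewrite [`|x|]mx_normrE; apply: bigmax_le => // -[i j] _ /=.
by rewrite ord1.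
Qed.

Lemma coord_le_mx_norm m (x : 'rV[R]_m) i : `|x ord0 i| <= `|x|.
Proof.
rewrite [`|x|]mx_normrE.
exact: (@le_bigmax _ _ _ 0 (fun ij : 'I_1 * 'I_m => `|x ij.1 ij.2|) (ord0, i)).
Qed.

End Euclid.

(** * Directional derivatives *)

Section Directional.
Context {R : realType} {V W : normedModType R}.
Implicit Types (f : V -> W) (x d : V).

Lemma cvg_dderiv f x d w : dquot f x d t @[t --> 0^'+] --> w ->
  dderiv f x d = w.
Proof. by move=> fw; apply: (cvg_lim _ fw); exact: norm_hausdorff. Qed.

Lemma cvg_dderiv2 f x d w : dquot2 f x d t @[t --> 0^'+] --> w ->
  dderiv2 f x d = w.
Proof. by move=> fw; apply: (cvg_lim _ fw); exact: norm_hausdorff. Qed.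

(** Tangent and radial cones only speak of a sequence of steps.  Once a
    one-sided limit is known to exist, such a sequence determines its value. *)
Lemma at_right_lim_along_seq (f : R -> W) (w w' : W) (tau : nat -> R) :
  f t @[t --> 0^'+] --> w ->
  (forall k, 0 < tau k) -> tau @ \oo --> 0 ->
  f (tau k) @[k --> \oo] --> w' -> w = w'.
Proof.
move=> fw tau_gt0 tau0; apply: cvg_unique; first exact: norm_hausdorff.
apply: cvg_comp fw => A [e /= e0 eA].
have /cvgrPdist_lt/(_ _ e0) := tau0; apply: filterS => k ke.
exact: eA.
Qed.

End Directional.

Section DirectionalNorm1.
Context {R : realType} {V : normedModType R} {m : nat}.
Implicit Types (h : V -> 'rV[R]_m) (x d : V).

(** The 1-norm is not differentiable, but a direction along which [h] moves
    straight towards the origin causes no trouble: up to [o(t)] the value at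
    [x + t d] is [(1 - t) h x], whose 1-norm is [(1 - t) |h x|_1].  The case
    [h x = 0] is the one of a vanishing derivative at a zero of [h]. *)
Lemma dquot_norm1 h x d : dquot h x d t @[t --> 0^'+] --> - h x ->
  dquot (fun y => norm1 (h y) : R) x d t @[t --> 0^'+] --> - norm1 (h x).
Proof.
move=> hx; rewrite -subr_cvg0; apply/norm_cvg0P.
have : norm1 (dquot h x d t + h x) @[t --> 0^'+] --> (0 : R).
  have hx0 := cvgD hx (cvg_cst (h x)).
  have := cvg_comp _ _ (hx0 _ _) (@norm1_continuous _ _ _).
  by rewrite addNr norm1_0; exact.
apply: (@squeeze_cvgr _ _ _ _ (fun=> 0)); [|exact: cvg_cst].
near=> t.
have t0 : 0 < t by near: t; exact: nbhs_right_gt.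
have t1 : t < 1 by near: t; exact: nbhs_right_lt.
rewrite normr_ge0/=.
have -> : dquot h x d t + h x = t^-1 *: (h (x + t *: d) - (1 - t) *: h x).
  rewrite /dquot !scalerBr scalerA mulrBr mulr1 mulVf ?gt_eqF//.
  by rewrite scalerBl scale1r opprB addrAC addrA.
rewrite norm1Z.
have -> : dquot (fun y => norm1 (h y) : R) x d t - - norm1 (h x) =
   t^-1 * (norm1 (h (x + t *: d)) - norm1 ((1 - t) *: h x)).
  rewrite norm1Z ger0_norm ?subr_ge0 ?ltW// /dquot /GRing.scale/=.
  by field; rewrite gt_eqF.
by rewrite normrM ler_wpM2l// ler_norm1_dist.
Unshelve. all: by end_near.
Qed.

(** If [h] vanishes to second order along [d], then [|h|_1] does, because
    the second-order quotient of [|h|_1] is the 1-norm of that of [h]. *)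
Lemma dquot2_norm1 h x d : h x = 0 ->
  dquot h x d t @[t --> 0^'+] --> (0 : 'rV_m) ->
  dquot2 h x d t @[t --> 0^'+] --> (0 : 'rV_m) ->
  dquot2 (fun y => norm1 (h y) : R) x d t @[t --> 0^'+] --> (0 : R).
Proof.
move=> hx dh d2h.
have dnorm : dderiv (fun y => norm1 (h y) : R) x d = 0.
  have := @dquot_norm1 h x d; rewrite hx norm1_0 !oppr0 => /(_ dh).
  exact: cvg_dderiv.
have : norm1 (dquot2 h x d t) @[t --> 0^'+] --> (0 : R).
  by have := cvg_comp _ _ d2h (@norm1_continuous _ _ _); rewrite norm1_0.
apply: cvg_trans; apply: near_eq_cvg; near=> t.
rewrite /dquot2 dnorm (cvg_dderiv dh) hx norm1_0 !scaler0 !subr0 norm1Z.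
by rewrite ger0_norm// invr_ge0 divr_ge0// sqr_ge0.
Unshelve. all: by end_near.
Qed.

End DirectionalNorm1.

(** * Sums, layers and prefixes *)

(** With [S_l = sum_(j < l) a_j] the hypothesis reads
    [S_(l+1) <= (1 + K_l) S_l + b_l], which is iterated.  As [S_0 = 0], the sign
    of [K 0] is irrelevant. *)
Lemma discrete_gronwall (R : realDomainType) L (a b K : 'I_L -> R) :
  (forall l : 'I_L, (0 < l)%N -> 0 <= K l) ->
  (forall l, a l <= b l + K l * \sum_(j < L | (j < l)%N) a j) ->
  \sum_l a l <= \sum_l b l * \prod_(j < L | (l < j)%N) (1 + K j).
Proof.
elim: L a b K => [|L IH] a b K K_ge0 ab; first by rewrite !big_ord0.
pose w := widen_ord (leqnSn L).
have prefix_sum (m : 'I_L.+1) : (m <= L)%N ->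
    \sum_(j < L.+1 | (j < m)%N) a j = \sum_(j < L | (j < m)%N) a (w j).
  move=> mL; rewrite big_mkcond big_ord_recr/= ltnNge mL/= addr0.
  by rewrite -big_mkcond.
rewrite [leLHS]big_ord_recr [leRHS]big_ord_recr/=.
rewrite [X in _ <= _ + _ * X]big_pred0 ?mulr1 => [|j]; last first.
  by rewrite ltnNge -ltnS ltn_ord.
have {}IH : \sum_(l < L) a (w l) <=
    \sum_(l < L) b (w l) * \prod_(j < L | (l < j)%N) (1 + K (w j)).
  apply: IH => l; first exact: (K_ge0 (w l)).
  by apply: le_trans (ab (w l)) _; rewrite prefix_sum//= ltnW.
have -> : \sum_(l < L) b (w l) * \prod_(j < L.+1 | (w l < j)%N) (1 + K j) =
  (\sum_(l < L) b (w l) * \prod_(j < L | (l < j)%N) (1 + K (w j)))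
  * (1 + K ord_max).
  rewrite mulr_suml; apply: eq_bigr => l _; rewrite -mulrA; congr (_ * _).
  by rewrite big_mkcond big_ord_recr/= ltn_ord -big_mkcond.
have := ab ord_max; rewrite prefix_sum//=.
under eq_bigl do rewrite ltn_ord.
set S := (\sum_(l < L) a (w l)) in IH *.
set B := (\sum_(l < L) _) in IH *.
move=> amax; rewrite addrC (addrC (B * _)) mulrDr mulr1.
apply: le_trans (lerD amax IH) _.
rewrite -addrA lerD2l addrC lerD2l mulrC.
have [L0|L0] := posnP L; last by rewrite ler_wpM2r// K_ge0.
suff -> : B = S by [].
by rewrite /B /S !big1// => -[i iL] _; exfalso; rewrite L0 in iL.
Qed.

Section Layers.
Context {R : realType} {n L : nat} {N : nat -> nat}.
Implicit Types (u v : 'rV[R]_(Nbar N L)) (z d : 'rV[R]_(n + Nbar N L)).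

Lemma layer_line u v t (l : 'I_L) :
  layer (u + t *: v) l = layer u l + t *: layer v l.
Proof. by apply/rowP => i; rewrite !mxE. Qed.

Lemma layerB u v (l : 'I_L) : layer (u - v) l = layer u l - layer v l.
Proof. by apply/rowP => i; rewrite !mxE. Qed.

Lemma layer_norm u (l : 'I_L) : `|layer u l| <= `|u|.
Proof. by apply: mx_norm_le => // i; rewrite mxE; exact: coord_le_mx_norm. Qed.

Lemma norm2_le_sum_layers u : norm2 u <= \sum_l norm2 (layer u l).
Proof. by rewrite -[in leLHS](submxrowK u); exact: norm2_mxrow_le. Qed.

Lemma norm2_prefix_le u (l : 'I_L) :
  norm2 (Defs.prefix u l) <= \sum_(j < L | (j < l)%N) norm2 (layer u j).
Proof.
by rewrite (big_ord_narrow (ltnW (ltn_ord l))); exact: norm2_mxrow_le.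
Qed.

(** A triangular system is solvable layer by layer.  The solution is the
    feasible point [z0] of the problem without [theta] whose layer maps are [Phi]. *)
Lemma layers_rec (Phi : forall l : 'I_L, 'rV[R]_(Nbar N l) -> 'rV[R]_(N l)) :
  exists u, forall l, layer u l = Phi l (Defs.prefix u l).
Proof.
pose psi (l : 'I_L) (x : 'rV[R]_(0 + Nbar N l)) := Phi l (rsubmx x).
exists (u_of (z0 psi)) => l.
by rewrite (z0_feasible psi) /psi_at /psi row_mxKr.
Qed.

Definition layer_input z (l : 'I_L) : 'rV[R]_(n + Nbar N l) :=
  row_mx (theta_of z) (Defs.prefix (u_of z) l).

Lemma layer_input_line z d t l :
  layer_input (z + t *: d) l = layer_input z l + t *: layer_input d l.
Proof.
rewrite /layer_input scale_row_mx add_row_mx; congr row_mx.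
  by apply/rowP => i; rewrite !mxE.
by apply/rowP => i; rewrite !mxE.
Qed.

Lemma layer_inputB z d l :
  layer_input (z - d) l = layer_input z l - layer_input d l.
Proof. by rewrite -scaleN1r layer_input_line scaleN1r. Qed.

Lemma layer_input_norm z l : `|layer_input z l| <= `|z|.
Proof.
apply: mx_norm_le => // i; rewrite mxE.
by case: splitP => j _; rewrite !mxE; exact: coord_le_mx_norm.
Qed.

End Layers.

(** * The objective is twice directionally differentiable *)

Section Objective.
Context {R : realType} {n L : nat} {N : nat -> nat}.
Variables (lambda : R) (g : 'rV[R]_(Nbar N L) -> R).
Hypothesis g_twice : forall u, twice_ddifferentiable g u.
Local Notation Z := 'rV[R]_(n + Nbar N L).
Implicit Types (z d : Z).

Lemma norm2_line m (x y : 'rV[R]_m) t :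
  norm2 (x + t *: y) ^+ 2 =
  norm2 x ^+ 2 + 2 * t * \sum_i x ord0 i * y ord0 i + t ^+ 2 * norm2 y ^+ 2.
Proof.
rewrite !sqr_norm2 !mulr_sumr -!big_split/=.
by apply: eq_bigr => i _; rewrite !mxE; ring.
Qed.

Lemma objF_line z d t : objF lambda g (z + t *: d) =
  g (u_of z + t *: u_of d) + lambda * norm2 (theta_of z + t *: theta_of d) ^+ 2.
Proof.
rewrite /objF /u_of /theta_of.
have -> : rsubmx (z + t *: d) = rsubmx z + t *: rsubmx d.
  by apply/rowP => i; rewrite !mxE.
suff -> : lsubmx (z + t *: d) = lsubmx z + t *: lsubmx d by [].
by apply/rowP => i; rewrite !mxE.
Qed.

Lemma objF_dderiv z d : dquot (objF lambda g) z d t @[t --> 0^'+] -->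
  dderiv g (u_of z) (u_of d)
  + 2 * lambda * \sum_i theta_of z ord0 i * theta_of d ord0 i.
Proof.
set ip := \sum_i _.
have t_cvg : t * norm2 (theta_of d) ^+ 2 @[t --> (0 : R)^'+] --> (0 : R).
  rewrite -[X in _ --> X](mul0r (norm2 (theta_of d) ^+ 2)).
  by apply: cvgM; [exact: cvg_at_right_filter cvg_id|exact: cvg_cst].
have : dquot g (u_of z) (u_of d) t + (2 * lambda * ip +
    lambda * (t * norm2 (theta_of d) ^+ 2)) @[t --> 0^'+] -->
    dderiv g (u_of z) (u_of d) + (2 * lambda * ip + lambda * 0).
  apply: cvgD; first exact: (g_twice (u_of z) (u_of d)).1.
  by apply: cvgD; [exact: cvg_cst|apply: cvgM => //; exact: cvg_cst].
rewrite mulr0 addr0; apply: cvg_trans; apply: near_eq_cvg; near=> t.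
have t0 : 0 < t by near: t; exact: nbhs_right_gt.
rewrite /dquot objF_line norm2_line -/ip /objF /GRing.scale/=.
by field; rewrite gt_eqF.
Unshelve. all: by end_near.
Qed.

Lemma objF_dderiv2 z d : cvg (dquot2 (objF lambda g) z d t @[t --> 0^'+]).
Proof.
set ip := \sum_i theta_of z ord0 i * theta_of d ord0 i.
apply/cvg_ex; exists (dderiv2 g (u_of z) (u_of d)
  + 2 * lambda * norm2 (theta_of d) ^+ 2).
have : dquot2 g (u_of z) (u_of d) t + 2 * lambda * norm2 (theta_of d) ^+ 2
   @[t --> 0^'+] -->
    dderiv2 g (u_of z) (u_of d) + 2 * lambda * norm2 (theta_of d) ^+ 2.
  by apply: cvgD; [exact: (g_twice (u_of z) (u_of d)).2|exact: cvg_cst].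
apply: cvg_trans; apply: near_eq_cvg; near=> t.
have t0 : 0 < t by near: t; exact: nbhs_right_gt.
rewrite /dquot2 (cvg_dderiv (objF_dderiv (z:=z) (d:=d))) objF_line.
rewrite norm2_line -/ip /objF /GRing.scale/=.
by field; rewrite gt_eqF.
Unshelve. all: by end_near.
Qed.

End Objective.

(** * The residuals and the penalty function *)

Section Penalty.
Context {R : realType} {n L : nat} {N : nat -> nat}.
Variables (lambda : R) (beta : 'I_L -> R) (g : 'rV[R]_(Nbar N L) -> R).
Variable psi : forall l : 'I_L, 'rV[R]_(n + Nbar N l) -> 'rV[R]_(N l).
Hypothesis g_twice : forall u, twice_ddifferentiable g u.
Arguments psi : clear implicits.
Hypothesis psi_twice : forall (l : 'I_L) x, twice_ddifferentiable (psi l) x.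
Local Notation Z := 'rV[R]_(n + Nbar N L).
Implicit Types (z d : Z).

Definition residual (l : 'I_L) z : 'rV[R]_(N l) :=
  layer (u_of z) l - psi l (layer_input z l).

Lemma residual_eq0P z : feasible0 psi z <-> forall l, residual l z = 0.
Proof.
split=> h l; first by rewrite /residual h subrr.
by apply/eqP; rewrite -subr_eq0; apply/eqP; exact: h l.
Qed.

Lemma residual_line l z d t : residual l (z + t *: d) - residual l z =
  t *: layer (u_of d) l
  - (psi l (layer_input z l + t *: layer_input d l) - psi l (layer_input z l)).
Proof.
rewrite /residual layer_input_line.
have -> : u_of (z + t *: d) = u_of z + t *: u_of d.
  by apply/rowP => i; rewrite !mxE.
rewrite layer_line.
move: (layer (u_of z) l) (layer (u_of d) l) (psi l _) (psi l _) => a b c e.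
by apply/rowP => i; rewrite !mxE; ring.
Qed.

Lemma residual_dquot l z d t : 0 < t ->
  dquot (residual l) z d t =
  layer (u_of d) l - dquot (psi l) (layer_input z l) (layer_input d l) t.
Proof.
move=> t0; rewrite /dquot residual_line scalerBr scalerA mulVf ?gt_eqF//.
by rewrite scale1r.
Qed.

Lemma residual_dderiv l z d :
  dquot (residual l) z d t @[t --> 0^'+] -->
  layer (u_of d) l - dderiv (psi l) (layer_input z l) (layer_input d l).
Proof.
have : (layer (u_of d) l - dquot (psi l) (layer_input z l) (layer_input d l) t)
  @[t --> 0^'+] -->
  layer (u_of d) l - dderiv (psi l) (layer_input z l) (layer_input d l).
  by apply: cvgB; [exact: cvg_cst|exact: (psi_twice _ _).1].
apply: cvg_trans; apply: near_eq_cvg; near=> t.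
by rewrite residual_dquot//; near: t; exact: nbhs_right_gt.
Unshelve. all: by end_near.
Qed.

Lemma residual_dderiv2 l z d :
  dquot2 (residual l) z d t @[t --> 0^'+] -->
  - dderiv2 (psi l) (layer_input z l) (layer_input d l).
Proof.
have : (- dquot2 (psi l) (layer_input z l) (layer_input d l) t)
  @[t --> 0^'+] -->
  - dderiv2 (psi l) (layer_input z l) (layer_input d l).
  by apply: cvgN; exact: (psi_twice _ _).2.
apply: cvg_trans; apply: near_eq_cvg; near=> t.
rewrite /dquot2 (cvg_dderiv (residual_dderiv (l:=l) (z:=z) (d:=d))).
rewrite residual_line.
rewrite -scalerN; congr (_ *: _).
move: (layer _ _) (psi l _) (psi l _) (dderiv _ _ _) => a b c e.
by apply/rowP => i; rewrite !mxE; ring.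
Unshelve. all: by end_near.
Qed.

Lemma objThetaE z : objTheta lambda beta g psi z =
  objF lambda g z + \sum_l beta l * norm1 (residual l z).
Proof. by []. Qed.

(** The condition on the residuals covers both uses: the descent direction at an
    infeasible point, and the directions tangent to the feasible set at a
    feasible point, where it says that the derivatives vanish. *)
Lemma objTheta_dderiv z d :
  (forall l, dquot (residual l) z d t @[t --> 0^'+] --> - residual l z) ->
  dquot (objTheta lambda beta g psi) z d t @[t --> 0^'+] -->
  dderiv (objF lambda g) z d - \sum_l beta l * norm1 (residual l z).
Proof.
move=> rd.
have : dquot (objF lambda g) z d t +
    \sum_l beta l * dquot (fun y => norm1 (residual l y) : R) z d t
    @[t --> 0^'+] -->
    dderiv (objF lambda g) z d + \sum_l beta l * - norm1 (residual l z).
  apply: cvgD.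
    rewrite (cvg_dderiv (objF_dderiv g_twice (z:=z) (d:=d))).
    exact: objF_dderiv.
  apply: cvgr_sum => l; apply: cvgM; first exact: cvg_cst.
  exact: dquot_norm1.
under [X in _ + X]eq_bigr do rewrite mulrN.
rewrite sumrN; apply: cvg_trans; apply: near_eq_cvg; near=> t.
rewrite /dquot !objThetaE /GRing.scale/=.
under eq_bigr do rewrite mulrCA mulrBr.
by rewrite -mulr_sumr -mulrDr sumrB; congr (_ * _); ring.
Unshelve. all: by end_near.
Qed.

Lemma objTheta_dderiv2 z d : (forall l, residual l z = 0) ->
  (forall l, dquot (residual l) z d t @[t --> 0^'+] --> (0 : 'rV_(N l))) ->
  (forall l, dquot2 (residual l) z d t @[t --> 0^'+] --> (0 : 'rV_(N l))) ->
  dquot2 (objTheta lambda beta g psi) z d t @[t --> 0^'+] -->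
  dderiv2 (objF lambda g) z d.
Proof.
move=> rz rd rd2.
have dTheta : dderiv (objTheta lambda beta g psi) z d
    = dderiv (objF lambda g) z d.
  rewrite (cvg_dderiv (objTheta_dderiv _)); last by move=> l; rewrite rz oppr0.
  by rewrite big1 ?subr0// => l _; rewrite rz norm1_0 mulr0.
have dnorm l : dderiv (fun y => norm1 (residual l y) : R) z d = 0.
  have := @dquot_norm1 _ _ _ (residual l) z d.
  by rewrite rz norm1_0 !oppr0 => /(_ (rd l))/cvg_dderiv.
have : dquot2 (objF lambda g) z d t +
    \sum_l beta l * dquot2 (fun y => norm1 (residual l y) : R) z d t
    @[t --> 0^'+] -->
    dderiv2 (objF lambda g) z d + \sum_l beta l * 0.
  apply: cvgD; first exact: objF_dderiv2.
  apply: cvgr_sum => l; apply: cvgM; first exact: cvg_cst.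
  exact: dquot2_norm1.
rewrite [X in _ + X]big1 ?addr0 => [|l _]; last by rewrite mulr0.
apply: cvg_trans; apply: near_eq_cvg; near=> t.
rewrite /dquot2 !objThetaE dTheta /GRing.scale/=.
under eq_bigr do rewrite dnorm mulr0 subr0 mulrCA mulrBr.
rewrite -mulr_sumr -mulrDr sumrB; congr (_ * _).
ring.
Unshelve. all: by end_near.
Qed.

(** Reading off layers and prefixes does not increase the maximum norm, so only
    [psi l] matters. *)
Lemma residual_lipschitz z (l : 'I_L) : locally_lipschitz (psi l) ->
  exists2 C, 0 <= C & exists2 A : set Z, nbhs z A &
    forall x y, A x -> A y -> `|residual l x - residual l y| <= C * `|x - y|.
Proof.
move=> /(_ (layer_input z l))[A zA [M [_ psiM]]].
exists (1 + (`|M| + 1)); first by rewrite !addr_ge0.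
exists [set x | A (layer_input x l)].
  have cont : layer_input x l @[x --> z] --> layer_input z l.
    apply/(@cvgrPdist_lt _ _ _ (nbhs z)) => e e0; near=> x.
    rewrite -layer_inputB; apply: le_lt_trans (layer_input_norm _ _) _.
    by near: x; exact: cvgr_dist_lt.
  exact: cont zA.
move=> x y Ax Ay.
have -> : residual l x - residual l y =
    layer (u_of x - u_of y) l
    - (psi l (layer_input x l) - psi l (layer_input y l)).
  rewrite layerB /residual.
  move: (layer _ _) (layer _ _) (psi l _) (psi l _) => a b c e.
  by apply/rowP => i; rewrite !mxE; ring.
apply: le_trans (ler_normB _ _) _; rewrite mulrDl mul1r lerD//.
  apply: le_trans (layer_norm _ _) _; apply: mx_norm_le => // i.
  rewrite !mxE -[X in _ <= `|X|]/(x - y).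
  have := coord_le_mx_norm (x - y) (rshift n i); by rewrite !mxE.
have := psiM (`|M| + 1).
rewrite (le_lt_trans (ler_norm M)) ?ltrDl// => /(_ isT).
move=> /(_ (layer_input x l, layer_input y l) (conj Ax Ay))/= /le_trans; apply.
by rewrite ler_wpM2l ?addr_ge0// -layer_inputB layer_input_norm.
Unshelve. all: by end_near.
Qed.

(** With feasible [y_k] and [(y_k - z) / tau_k] tending to [d], the Lipschitz
    bound gives
    [|r_l(z + tau_k d)| = |r_l(z + tau_k d) - r_l(y_k)| <= C |z + tau_k d - y_k|],
    which is [o(tau_k)]. *)
Lemma tangent_residual z d (l : 'I_L) : locally_lipschitz (psi l) ->
  feasible0 psi z -> tangent_cone (feasible0 psi) z d ->
  dquot (residual l) z d t @[t --> 0^'+] --> (0 : 'rV_(N l)).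
Proof.
move=> psi_lip /residual_eq0P rz [y [tau [yz yF tau_gt0 tau0 yd]]].
have rd := residual_dderiv (l:=l) (z:=z) (d:=d).
rewrite -(at_right_lim_along_seq (w' := 0) rd tau_gt0 tau0)//.
have [C C0 [A zA rC]] := residual_lipschitz z psi_lip.
have line_z : z + tau k *: d @[k --> \oo] --> z.
  have : z + tau k *: d @[k --> \oo] --> z + 0 *: d;
    last by rewrite scale0r addr0.
  by apply: cvgD; [exact: cvg_cst|apply: cvgZ => //; exact: cvg_cst].
apply/norm_cvg0P.
have : C * `|d - (tau k)^-1 *: (y k - z)| @[k --> \oo] --> (0 : R).
  have : C * `|d - (tau k)^-1 *: (y k - z)| @[k --> \oo] --> C * `|d - d|;
    last by rewrite subrr normr0 mulr0.
  apply: cvgM; first exact: cvg_cst.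
  by apply: cvg_norm; apply: cvgB => //; exact: cvg_cst.
apply: (@squeeze_cvgr _ _ _ _ (fun=> 0)); [|exact: cvg_cst].
near=> k.
have tk := tau_gt0 k.
have ry : residual l (y k) = 0 by move/residual_eq0P : (yF k).
rewrite normr_ge0/= /dquot rz -ry normrZ.
have -> : d - (tau k)^-1 *: (y k - z) = (tau k)^-1 *: (z + tau k *: d - y k).
  rewrite !scalerBr scalerDr scalerA mulVf ?gt_eqF// scale1r opprB.
  by rewrite [LHS]addrCA addrA.
rewrite normrZ mulrCA ler_wpM2l// rC//.
- by near: k; exact: line_z.
- by near: k; exact: yz.
Unshelve. all: by end_near.
Qed.

Lemma radial_residual z d (l : 'I_L) :
  feasible0 psi z -> radial_cone (feasible0 psi) z d ->
  dquot (residual l) z d t @[t --> 0^'+] --> (0 : 'rV_(N l)) /\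
  dquot2 (residual l) z d t @[t --> 0^'+] --> (0 : 'rV_(N l)).
Proof.
move=> /residual_eq0P rz [tau [tau_gt0 tau0 rad]].
have rtau k : residual l (z + tau k *: d) = 0 by move/residual_eq0P : (rad k).
have d0 : dquot (residual l) z d t @[t --> 0^'+] --> (0 : 'rV_(N l)).
  have rd := residual_dderiv (l:=l) (z:=z) (d:=d).
  rewrite -(at_right_lim_along_seq (w' := 0) rd tau_gt0 tau0)//.
  rewrite (_ : (fun k => _) = fun=> 0); first exact: cvg_cst.
  by apply/funext => k; rewrite /dquot rtau rz subrr scaler0.
split=> //; have rd2 := residual_dderiv2 (l:=l) (z:=z) (d:=d).
rewrite -(at_right_lim_along_seq (w' := 0) rd2 tau_gt0 tau0)//.
rewrite (_ : (fun k => _) = fun=> 0); first exact: cvg_cst.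
apply/funext => k.
by rewrite /dquot2 (cvg_dderiv d0) rtau rz scaler0 !subr0 scaler0.
Qed.

(** * Exactness of the penalty, and the theorem *)

(** A nonzero residual at a stationary point is excluded by the direction that
    drives all residuals to zero at unit rate: the decrease of the penalty along
    it outweighs the increase of the objective, by the choice of [beta]. *)
Lemma D1_lev_feasible (Kg : R) (K : 'I_L -> R) z :
  0 <= Kg -> (forall l : 'I_L, (0 < l)%N -> 0 <= K l) ->
  lipschitz_constants lambda beta g psi Kg K ->
  (forall l : 'I_L, Kg * \prod_(j < L | (l < j)%N) (1 + K j) < beta l) ->
  D1 lambda beta g psi z -> levTheta lambda beta g psi z -> feasible0 psi z.
Proof.
move=> Kg_ge0 K_ge0 [eps eps_gt0 lip] pen zD1 zlev; apply/residual_eq0P.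
(* The equation for layer l says exactly that r_l'(z; (0, v)) = - r_l(z). *)
have [v vE] := layers_rec (fun l x =>
  dderiv (psi l) (layer_input z l) (row_mx 0 x) - residual l z).
pose d : Z := row_mx 0 v.
have uE : u_of d = v by exact: row_mxKr.
have inputE l : layer_input d l = row_mx 0 (Defs.prefix v l).
  by rewrite /layer_input /theta_of row_mxKl uE.
have zE t : z + t *: d = row_mx (theta_of z) (u_of z + t *: v).
  by rewrite -[z in LHS]hsubmxK scale_row_mx scaler0 add_row_mx addr0.
have rd l : dquot (residual l) z d t @[t --> 0^'+] --> - residual l z.
  have := residual_dderiv (l:=l) (z:=z) (d:=d).
  by rewrite uE vE inputE addrAC subrr add0r.
have z_lev : lev_nbhd lambda beta g psi eps (row_mx (theta_of z) (u_of z)).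
  have := zE 0; rewrite !scale0r !addr0 => <-.
  exists z => //; exists 0; rewrite ?addr0//=.
  by rewrite -(scale0r (0 : Z)) norm2Z normr0 mul0r ltW.
have line_lev : \forall t \near 0^'+,
    lev_nbhd lambda beta g psi eps (row_mx (theta_of z) (u_of z + t *: v)).
  have d1 : 0 < norm2 d + 1 by rewrite ltr_wpDl ?norm2_ge0.
  near=> t; have t0 : 0 < t by near: t; exact: nbhs_right_gt.
  have te : t <= eps / (norm2 d + 1).
    by near: t; apply: nbhs_right_le; rewrite divr_gt0.
  rewrite -zE; exists z => //; exists (t *: d) => //=.
  rewrite norm2Z gtr0_norm//; rewrite ler_pdivlMr// in te.
  by apply: le_trans te; rewrite ler_wpM2l ?(ltW t0)// lerDl.
have dg : dderiv g (u_of z) v <= Kg * norm2 v.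
  apply: (ler_cvg_to (g_twice (u_of z) v).1 (cvg_cst _)); near=> t.
  have t0 : 0 < t by near: t; exact: nbhs_right_gt.
  rewrite /dquot [_ *: _]/(_ * _) ler_pdivrMl//.
  have t_lev : lev_nbhd lambda beta g psi eps
    (row_mx (theta_of z) (u_of z + t *: v)) by near: t.
  have [+ _] := lip _ _ _ t_lev z_lev.
  rewrite addrAC subrr add0r norm2Z (gtr0_norm t0) mulrCA.
  exact: le_trans (ler_norm _).
have dpsi (l : 'I_L) : (0 < l)%N ->
    norm2 (dderiv (psi l) (layer_input z l) (layer_input d l))
    <= K l * norm2 (Defs.prefix v l).
  move=> l0; have psi_cvg := (psi_twice (layer_input z l) (layer_input d l)).1.
  have := cvg_comp _ _ psi_cvg (@norm2_continuous _ _ _).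
  move=> /ler_cvg_to/(_ (cvg_cst _)); apply; near=> t.
  have t0 : 0 < t by near: t; exact: nbhs_right_gt.
  rewrite /= /dquot norm2Z gtr0_norm ?invr_gt0// ler_pdivrMl//.
  have t_lev : lev_nbhd lambda beta g psi eps
    (row_mx (theta_of z) (u_of z + t *: v)) by near: t.
  have [_ /(_ l l0)] := lip _ _ _ t_lev z_lev.
  have -> : Defs.prefix (u_of z + t *: v) l - Defs.prefix (u_of z) l =
      t *: Defs.prefix v l by apply/rowP => i; rewrite !mxE; ring.
  rewrite norm2Z (gtr0_norm t0) mulrCA; apply: le_trans.
  rewrite -layer_input_line zE /psi_at /layer_input /theta_of /u_of.
  by rewrite row_mxKl row_mxKr.
have v_le : norm2 v <=
    \sum_l norm2 (residual l z) * \prod_(j < L | (l < j)%N) (1 + K j).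
  apply: le_trans (norm2_le_sum_layers v) _; apply: discrete_gronwall => // l.
  rewrite [in leLHS]vE -inputE addrC; apply: le_trans (ler_norm2D _ _) _.
  (* The first map depends on theta alone, so it is constant along v. *)
  rewrite norm2N lerD2l; have [l0|l0] := posnP l.
    have -> : layer_input d l = 0.
      apply/rowP => i; rewrite inputE !mxE; case: splitP => j _; rewrite !mxE//.
      have Nl : Nbar N l = 0%N by rewrite /Nbar l0 big_ord0.
      by case: j => j jN; exfalso; rewrite Nl in jN.
    rewrite (_ : dderiv _ _ _ = 0).
      rewrite big1 ?mulr0 => [|j]; last by rewrite l0.
      by rewrite -(scale0r (0 : 'rV_(N l))) norm2Z normr0 mul0r.
    apply: cvg_dderiv; rewrite (_ : (fun t => _) = fun=> 0).
      exact: cvg_cst.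
    by apply/funext => t; rewrite /dquot scaler0 addr0 subrr scaler0.
  apply: le_trans (dpsi l l0) _.
  by rewrite ler_wpM2l ?K_ge0// norm2_prefix_le.
have := zD1 d; rewrite (cvg_dderiv (objTheta_dderiv rd)).
have -> : dderiv (objF lambda g) z d = dderiv g (u_of z) v.
  rewrite (cvg_dderiv (objF_dderiv g_twice (z:=z) (d:=d))) uE.
  rewrite big1 ?mulr0 ?addr0// => i _.
  by rewrite [theta_of d]row_mxKl [X in _ * X]mxE mulr0.
rewrite subr_ge0 => pen_le.
(* The terms below are nonnegative and stationarity bounds their sum by zero. *)
have gap_ge0 l : 0 <= (beta l - Kg * \prod_(j < L | (l < j)%N) (1 + K j))
    * norm1 (residual l z).
  by rewrite mulr_ge0 ?norm1_ge0// subr_ge0 ltW.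
have : \sum_l (beta l - Kg * \prod_(j < L | (l < j)%N) (1 + K j))
    * norm1 (residual l z) <= 0.
  under eq_bigr do rewrite mulrBl.
  rewrite sumrB subr_le0; apply: le_trans pen_le _; apply: le_trans dg _.
  apply: le_trans (ler_wpM2l Kg_ge0 v_le) _; rewrite mulr_sumr.
  apply: ler_sum => l _; rewrite -mulrA ler_wpM2l// mulrC ler_wpM2l//.
    apply: prodr_ge0 => j lj; rewrite addr_ge0// K_ge0//.
    exact: leq_ltn_trans lj.
  exact: norm2_le_norm1.
move=> gap_le0 l; apply: norm1_eq0; apply/eqP.
have /eqP : \sum_l (beta l - Kg * \prod_(j < L | (l < j)%N) (1 + K j))
    * norm1 (residual l z) = 0 by apply: le_anti; rewrite gap_le0 sumr_ge0.
rewrite psumr_eq0// => /allP/(_ l); rewrite mem_index_enum => /(_ isT)/=.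
by rewrite mulf_eq0 subr_eq0 gt_eqF.
Unshelve. all: by end_near.
Qed.

End Penalty.

Theorem theorem3p3 (R : realType) (n L : nat) (N : nat -> nat)
    (hn : (0 < n)%N) (hL : (0 < L)%N)
    (hN : forall l : 'I_L, (0 < N l)%N)
    (lambda : R) (hlambda : 0 < lambda)
    (g : 'rV[R]_(Nbar N L) -> R)
    (psi : forall l : 'I_L, 'rV[R]_(n + Nbar N l) -> 'rV[R]_(N l))
    (g_ge0 : forall u, 0 <= g u)
    (g_cont : continuous g)
    (psi_cont : forall l : 'I_L, continuous (psi l))
    (g_twice : forall u, twice_ddifferentiable g u)
    (psi_twice : forall (l : 'I_L) x, twice_ddifferentiable (psi l) x)
    (g_loclip : locally_lipschitz g)
    (psi_loclip : forall l : 'I_L, locally_lipschitz (psi l))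
    (beta : 'I_L -> R) (hbeta : forall l, 0 < beta l)
    (Kg : R) (K : 'I_L -> R)
    (hKg : 0 < Kg) (hK : forall l : 'I_L, (0 < l)%N -> 0 < K l)
    (hlip : lipschitz_constants lambda beta g psi Kg K)
    (hpen : forall l : 'I_L, Kg * \prod_(j < L | (l < j)%N) (1 + K j) < beta l) :
  SD1 lambda beta g psi `&` levTheta lambda beta g psi `<=`
  SD0 lambda g psi `&` levTheta lambda beta g psi.
Proof.
move=> z [[zD1 zSD1] zlev]; split=> //.
have zF : feasible0 psi z.
  apply: (D1_lev_feasible g_twice psi_twice _ _ hlip hpen zD1 zlev).
    exact: ltW.
  by move=> l l0; exact/ltW/hK.
have /residual_eq0P rz := zF.
have sum0 : \sum_l beta l * norm1 (residual psi l z) = 0.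
  by apply: big1 => l _; rewrite rz norm1_0 mulr0.
have dF d : (forall l,
      dquot (residual psi l) z d t @[t --> 0^'+] --> (0 : 'rV_(N l))) ->
    dderiv (objTheta lambda beta g psi) z d = dderiv (objF lambda g) z d.
  move=> rd.
  have rd' l :
      dquot (residual psi l) z d t @[t --> 0^'+] --> - residual psi l z.
    by rewrite rz oppr0.
  have := objTheta_dderiv (lambda:=lambda) (beta:=beta) g_twice rd'.
  by rewrite sum0 subr0; exact: cvg_dderiv.
split; first split=> //.
  by move=> d dT; rewrite -dF => // l; exact: tangent_residual.
move=> d dR Fd0.
have rd l := (radial_residual psi_twice l zF dR).1.
have rd2 l := (radial_residual psi_twice l zF dR).2.
have Theta2 := objTheta_dderiv2 (lambda:=lambda) beta g_twice rz rd rd2.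
rewrite -(cvg_dderiv2 Theta2).
by apply: zSD1; rewrite dF.
Qed.
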